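(* Let $m=1$ and $d\ge3$. The connection coefficients satisfy the following equations for all row indices $j\ge0$. (1) Suppose $0\le n\le d-2$. For $k=1,\dots,n+1$, $$b^{n,x}_{k,k}C^{(1,d)}_{j,\ell(n+1,k)}=\sum_{r=j-1}^{j+1}\mathcal{X}^{(1,d)}_{r,j}C^{(1,d)}_{r,\ell(n,k)}-\sum_{r=k}^{n}b^{n-1,x}_{k,r}C^{(1,d)}_{j,\ell(n-1,r)}-\sum_{r=1}^{n+1}a^{n,x}_{r,k}C^{(1,d)}_{j,\ell(n,r)}-\sum_{r=1}^{k-1}b^{n,x}_{r,k}C^{(1,d)}_{j,\ell(n+1,r)},$$ and $$b^{n,y}_{n+2,n+1}C^{(1,d)}_{j,\ell(n+1,n+2)}=\sum_{r=j-d}^{j+d}\mathcal{Y}^{(1,d)}_{r,j}C^{(1,d)}_{r,\ell(n,n+1)}-b^{n-1,y}_{n+1,n}C^{(1,d)}_{j,\ell(n-1,n)}-\sum_{r=1}^{n+1}a^{n,y}_{r,n+1}C^{(1,d)}_{j,\ell(n,r)}-\sum_{r=1}^{n+1}b^{n,y}_{r,n+1}C^{(1,d)}_{j,\ell(n+1,r)}.$$ (2) For $k=1,\dots,d$, $$b^{d-1,y}_{k,k}C^{(1,d)}_{j,\ell(d,k)}=\sum_{r=j-d}^{j+d}\mathcal{Y}^{(1,d)}_{r,j}C^{(1,d)}_{r,\ell(d-1,k)}-\sum_{r=\max\{k-1,1\}}^{d-1}b^{d-2,y}_{k,r}C^{(1,d)}_{j,\ell(d-2,r)}-\sum_{r=1}^{d}a^{d-1,y}_{r,k}C^{(1,d)}_{j,\ell(d-1,r)}-\sum_{r=1}^{k-1}b^{d-1,y}_{r,k}C^{(1,d)}_{j,\ell(d,r)}.$$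 (3) For $n\ge d$ and $k=1,\dots,d$, $$b^{n,y}_{k,k}C^{(1,d)}_{j,\ell(n+1,k)}=\sum_{r=j-d}^{j+d}\mathcal{Y}^{(1,d)}_{r,j}C^{(1,d)}_{r,\ell(n,k)}-\sum_{r=k}^{d}b^{n-1,y}_{k,r}C^{(1,d)}_{j,\ell(n-1,r)}-\sum_{r=1}^{d}a^{n,y}_{r,k}C^{(1,d)}_{j,\ell(n,r)}-\sum_{r=1}^{k-1}b^{n,y}_{r,k}C^{(1,d)}_{j,\ell(n+1,r)}.$$ The coefficients $b^{n,x}_{k,k}$, $b^{n,y}_{n+2,n+1}$, $b^{d-1,y}_{k,k}$, $b^{n,y}_{k,k}$ on the left-hand sides are determined (taken positive) by the requirement that the OPs have unit norm, i.e. that the column being computed satisfies $\big(\mathbf{C}^{(1,d)}_{\ell(n+1,k)}\big)^\top\mathbf{C}^{(1,d)}_{\ell(n+1,k)}=1=\langle Y^{(1,d)}_{n+1,k},Y^{(1,d)}_{n+1,k}\rangle_{\gamma_{1,d},w}$ (respectively for the columns $\ell(n+1,n+2)$ and $\ell(d,k)$).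
   Context: Let $w$ be a non-negative weight function whose support is an interval $I=(a,b)$, $(a,\infty)$ or $(-\infty,\infty)$, with all moments finite, and $\phi$ a real polynomial of degree $d$. Let $\gamma_{1,d}=\{(x,y):y=\phi(x),x\in I\}$; polynomials are considered in $\mathbb{R}[x,y]/\langle y-\phi(x)\rangle$ with inner product $\langle f,g\rangle_{\gamma_{1,d},w}=\int_I f(x,\phi(x))g(x,\phi(x))w(x)\,dx$. Let $P^{(1,d)}_{n,0}=p_n(w;x)$, $n\ge0$, be the orthonormal polynomials for $w$ with positive leading coefficients, and $J(w)$ their Jacobi matrix (infinite, symmetric, tridiagonal, entries $\langle p_i(w),xp_j(w)\rangle_w$, $i,j\ge0$). $\mathcal{X}^{(1,d)}=J(w)$ and $\mathcal{Y}^{(1,d)}=\phi(J(w))$, with entries $\mathcal{X}^{(1,d)}_{r,c},\mathcal{Y}^{(1,d)}_{r,c}$, $r,c\ge0$; they represent multiplication by $x$ and $y$ in the basis $\{P^{(1,d)}_{n,0}\}$. Orthonormal OPs $Y^{(1,d)}_{n,k}$, $n\ge0$, $1\le k\le\min\{n+1,d\}$, are constructed as follows (''orthogonalising $f$'' means subtracting from $f$ its orthogonal projection onto the span of all previously constructed OPs and dividing by the norm of the result). $Y^{(1,d)}_{0,1}=P^{(1,d)}_{0,0}$. For $0\le n\le d-2$: orthogonalise $xY^{(1,d)}_{n,k}$ to get $Y^{(1,d)}_{n+1,k}$, in the order $k=1,\dots,n+1$, then orthogonalise $yY^{(1,d)}_{n,n+1}$ to get $Y^{(1,d)}_{n+1,n+2}$.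 For $n\ge d-1$: orthogonalise $yY^{(1,d)}_{n,k}$ to get $Y^{(1,d)}_{n+1,k}$, in the order $k=1,\dots,d$. (These are OPs of degree $n$ on $\gamma_{1,d}$: degree meaning the lowest total degree among representatives modulo $y-\phi(x)$.) $\ell(n,k)=\frac{n(n+1)}2+k-1$ for $0\le n\le d-1$, $1\le k\le n+1$, and $\ell(n,k)=dn-\frac{d(d-1)}2+k-1$ for $n\ge d$, $1\le k\le d$. The connection coefficients are $C^{(1,d)}_{r,\ell(n,k)}=\langle Y^{(1,d)}_{n,k},P^{(1,d)}_{r,0}\rangle_{\gamma_{1,d},w}$, so $Y^{(1,d)}_{n,k}=\sum_{r\ge0}C^{(1,d)}_{r,\ell(n,k)}P^{(1,d)}_{r,0}$, and $\mathbf{C}^{(1,d)}_{\ell(n,k)}$ is the corresponding column. $a^{n,x}_{i,j}=\langle Y^{(1,d)}_{n,i},xY^{(1,d)}_{n,j}\rangle_{\gamma_{1,d},w}$, $b^{n,x}_{i,j}=\langle Y^{(1,d)}_{n+1,i},xY^{(1,d)}_{n,j}\rangle_{\gamma_{1,d},w}$, and $a^{n,y}_{i,j},b^{n,y}_{i,j}$ are defined likewise with $y$. Conventions: empty sums, terms with negative row index, and terms involving level $n-1=-1$ are zero. *)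

(* Defs.v *)
(* MathComp-Analysis development over an abstract [R : realType]. *)
From HB Require Import structures.
From mathcomp Require Import all_boot all_order all_algebra.
From mathcomp Require Import all_classical all_reals all_analysis.

Set Implicit Arguments.
Unset Strict Implicit.
Unset Printing Implicit Defensive.

Import Order.TTheory GRing.Theory Num.Theory.
Import numFieldNormedType.Exports.

Local Open Scope classical_set_scope.
Local Open Scope ring_scope.

Definition admissible_interval (R : realType) (I : interval R) : Prop :=
  [\/ exists a b : R, a < b /\ I = `]a, b[%R,
      exists a : R, I = `]a, +oo[%R
    | I = `]-oo, +oo[%R].

(* Support of the measure [w(x) dx]: the points all of whose open
   neighbourhoods have positive mass.  It does not depend on the values of [w]
   on a Lebesgue-null set. *)
Definition weight_support (R : realType) (w : R -> R) : set R :=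
  [set x | forall U : set R, open U -> U x ->
     (0 < \int[lebesgue_measure]_(t in U) (w t)%:E)%E].

(* A support is closed, so "the support is [I]", with [I] an open interval, is
   read up to closure. *)
Definition is_weight (R : realType) (I : interval R) (w : R -> R) : Prop :=
  [/\ measurable_fun setT w,
      forall x, 0 <= w x,
      weight_support w = closure [set` I]
    & forall n : nat,
        lebesgue_measure.-integrable [set` I] (fun x => (x ^+ n * w x)%:E)].

Definition ip_w (R : realType) (I : interval R) (w : R -> R)
    (f g : {poly R}) : R :=
  \int[lebesgue_measure]_(x in [set` I]) (f.[x] * g.[x] * w x).

Definition orthonormal_polys (R : realType) (I : interval R) (w : R -> R)
    (p : nat -> {poly R}) : Prop :=
  [/\ forall n, size (p n) = n.+1,
      forall n, 0 < lead_coef (p n)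
    & forall m n, ip_w I w (p m) (p n) = (m == n)%:R].

(* Infinite matrices, with rows and columns indexed by [nat].  The sum in the
   product is a finitely supported one (it is 0 when infinitely many terms are
   nonzero); only products of banded matrices are used below. *)
Definition imatrix (R : realType) := nat -> nat -> R.

Definition imx1 (R : realType) : imatrix R := fun i j => (i == j)%:R.

Definition imx_mul (R : realType) (A B : imatrix R) : imatrix R :=
  fun i j => \sum_(r \in [set: nat]) A i r * B r j.

Definition imx_exp (R : realType) (A : imatrix R) (k : nat) : imatrix R :=
  iter k (imx_mul A) (@imx1 R).

Definition imx_horner (R : realType) (q : {poly R}) (A : imatrix R)
    : imatrix R :=
  fun i j => \sum_(k < size q) q`_k * imx_exp A k i j.

Definition jacobi (R : realType) (I : interval R) (w : R -> R)
    (p : nat -> {poly R}) : imatrix R :=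
  fun i j => ip_w I w (p i) ('X * p j).

Definition col_sqnorm (R : realType) (c : nat -> R) : R :=
  \sum_(r \in [set: nat]) c r * c r.

(* R[x,y] is encoded as [{poly {poly R}}], with [y] the outer variable.
   Elements of R[x,y]/<y - phi(x)> are handled through representatives; the
   inner product only depends on the classes. *)
Definition bipoly (R : realType) := {poly {poly R}}.

Definition varx (R : realType) : bipoly R := ('X : {poly R})%:P.
Definition vary (R : realType) : bipoly R := 'X.

Definition eval_xy (R : realType) (f : bipoly R) (x y : R) : R :=
  (f.[y%:P]).[x].

Definition ip_curve (R : realType) (I : interval R) (w : R -> R)
    (phi : {poly R}) (f g : bipoly R) : R :=
  \int[lebesgue_measure]_(x in [set` I])
    (eval_xy f x phi.[x] * eval_xy g x phi.[x] * w x).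

Definition OP_P (R : realType) (p : nat -> {poly R}) (n : nat) : bipoly R :=
  (p n)%:P.

(* [s] is the list of the OPs constructed so far.  It is orthonormal, so the
   orthogonal projection of [f] onto its span is the sum of the
   [<f, q> q], [q] in [s]. *)
Definition orthogonalise (R : realType) (ip : bipoly R -> bipoly R -> R)
    (s : seq (bipoly R)) (f : bipoly R) : bipoly R :=
  let g := f - \sum_(q <- s) (ip f q)%:P *: q in
  ((Num.sqrt (ip g g))^-1)%:P *: g.

(* Position of [Y_{n,k}], [1 <= k <= min(n+1,d)], in order of construction. *)
Definition ell (d n k : nat) : nat :=
  if (n < d)%N then ((n * n.+1)./2 + k.-1)%N
  else (d * n - (d * d.-1)./2 + k.-1)%N.

(* The polynomials to be orthogonalised, in this order, to pass from level [n]
   to level [n+1]; [s] lists the OPs of levels [0], ..., [n]. *)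
Definition next_level (R : realType) (d n : nat) (s : seq (bipoly R))
    : seq (bipoly R) :=
  let Yn k := nth 0 s (ell d n k) in
  if (n <= d - 2)%N then
    rcons [seq varx R * Yn k | k <- iota 1 n.+1] (vary R * Yn n.+1)
  else [seq vary R * Yn k | k <- iota 1 d].

(* All the OPs of levels [0], ..., [n], in order of construction. *)
Fixpoint OPs_upto (R : realType) (I : interval R) (w : R -> R)
    (phi : {poly R}) (p : nat -> {poly R}) (d n : nat) : seq (bipoly R) :=
  match n with
  | 0 => [:: OP_P p 0]
  | n'.+1 =>
      let s := OPs_upto I w phi p d n' in
      foldl (fun t f => rcons t (orthogonalise (ip_curve I w phi) t f))
        s (next_level d n' s)
  end.

(* The [l]-th OP in order of construction; every level contains at least one
   OP, so [OPs_upto] at level [l] has more than [l] entries. *)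
Definition OP_seq (R : realType) (I : interval R) (w : R -> R)
    (phi : {poly R}) (p : nat -> {poly R}) (d l : nat) : bipoly R :=
  nth 0 (OPs_upto I w phi p d l) l.

Definition OP_Y (R : realType) (I : interval R) (w : R -> R)
    (phi : {poly R}) (p : nat -> {poly R}) (d n k : nat) : bipoly R :=
  OP_seq I w phi p d (ell d n k).

Definition connection (R : realType) (I : interval R) (w : R -> R)
    (phi : {poly R}) (p : nat -> {poly R}) (d : nat) : imatrix R :=
  fun r l => ip_curve I w phi (OP_seq I w phi p d l) (OP_P p r).

(* The coefficients [a^{n,v}_{i,j}] and [b^{n,v}_{i,j}], for [v] one of the
   variables [x], [y]. *)
Definition coef_a (R : realType) (I : interval R) (w : R -> R)
    (phi : {poly R}) (p : nat -> {poly R}) (d : nat) (v : bipoly R)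
    (n i j : nat) : R :=
  ip_curve I w phi (OP_Y I w phi p d n i) (v * OP_Y I w phi p d n j).

Definition coef_b (R : realType) (I : interval R) (w : R -> R)
    (phi : {poly R}) (p : nat -> {poly R}) (d : nat) (v : bipoly R)
    (n i j : nat) : R :=
  ip_curve I w phi (OP_Y I w phi p d n.+1 i) (v * OP_Y I w phi p d n j).

(* The column [c0] is a positive multiple [1 / b0] of the column [F], and the
   requirement that it have unit norm determines [b0] and [c0] from [F]. *)
Definition unit_norm_determines (R : realType) (F : nat -> R)
    (b0 : R) (c0 : nat -> R) : Prop :=
  [/\ 0 < b0,
      forall j, b0 * c0 j = F j,
      col_sqnorm c0 = 1
    & forall (b : R) (c : nat -> R), 0 < b -> (forall j, b * c j = F j) ->
        col_sqnorm c = 1 -> b = b0 /\ c = c0].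

(* Main.v *)
Require Import Defs.
From HB Require Import structures.
From mathcomp Require Import all_boot all_order all_algebra.
From mathcomp Require Import all_classical all_reals all_analysis.
From mathcomp Require Import zify.

Import Order.TTheory GRing.Theory Num.Theory.
Local Open Scope ring_scope.

Set Implicit Arguments.
Unset Strict Implicit.
Unset Printing Implicit Defensive.

(** Restricting a polynomial in x, y to the curve turns it into the univariate
    polynomial obtained by y := phi(x), and the inner product of the curve into
    L(f g), where L is the moment functional of the weight
    ([ip_curve_ip_w], [moment_functional]).  Since the p_n are orthonormal and
    of degree n, Parseval's identity holds for L; it makes L positive definite
    ([parseval], [moment_posdef]) and identifies phi(J), a matrix of finite
    sums, with the matrix of multiplication by phi ([imx_horner_jacobi]).

    The y^b x^a with a < d, ordered by a + b and then by b, are linearly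
    independent on the curve, their univariate degrees a + d b being distinct
    ([exponent_inj], [distinct_degree_free]).  In the construction of the
    Y_{n,k}, multiplication by x or y maps this list into itself by a strictly
    increasing map of positions ([shift_x], [shift_y]): no monomial x^d is ever
    produced, as x is used only below level d - 1.  Hence, by induction, the
    l-th polynomial Y_l has the l-th monomial as leading term, the residual to
    be normalised is never zero, and the Y_l are orthonormal
    ([gram_schmidt_step], [gram_schmidt]).

    If Y_(s i) is the normalised residual of v Y_i, then v Y_i is the sum of
    its projections on the Y_t with t <= s i.  Multiplication by v being
    symmetric, the coefficient <v Y_i, Y_t> = <Y_i, v Y_t> vanishes when
    s t < i, and this bounds the sum from below ([connection_recurrence]).
    Pairing with p_j gives the recurrences of the connection coefficients
    ([curve_recurrence]); their first terms come from <v Y_i, p_j> =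
    <Y_i, v p_j> by the symmetry and bandedness of J and phi(J)
    ([banded_expansion]).  The coefficient <Y_(s i), v Y_i> is the norm of
    the residual, so it is positive, and it is the only positive number that
    scales the right-hand side to a unit column. *)

(** * Moment functionals and orthonormal polynomials *)

Section Moments.
Context (R : rcfType) (L : {scalar {poly R}}) (p : nat -> {poly R}).
Hypothesis size_p : forall n, size (p n) = n.+1.
Hypothesis p_orthonormal : forall m n, L (p m * p n) = (m == n)%:R.

Lemma momentZl a f g : L (a *: f * g) = a * L (f * g).
Proof. by rewrite -scalerAl linearZ. Qed.

Lemma momentZr a f g : L (f * (a *: g)) = a * L (f * g).
Proof. by rewrite -scalerAr linearZ. Qed.

Lemma moment_suml (I : Type) (s : seq I) (P : pred I) (F : I -> {poly R}) g :
  L ((\sum_(i <- s | P i) F i) * g) = \sum_(i <- s | P i) L (F i * g).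
Proof. by rewrite mulr_suml linear_sum. Qed.

Lemma moment_sumr (I : Type) (s : seq I) (P : pred I) (F : I -> {poly R}) g :
  L (g * (\sum_(i <- s | P i) F i)) = \sum_(i <- s | P i) L (g * F i).
Proof. by rewrite mulr_sumr linear_sum. Qed.

(** Induction on the degree: subtracting the multiple of p_n that cancels the
    top coefficient changes no Fourier coefficient of index below n. *)
Lemma fourier_expansion n (f : {poly R}) :
  (size f <= n)%N -> f = \sum_(i < n) L (f * p i) *: p i.
Proof.
elim: n f => [|n IHn] f le_f.
  by rewrite big_ord0; apply/eqP; rewrite -size_poly_leq0.
have lead_p : (p n)`_n != 0.
  by rewrite -[X in _`_X]/(n.+1.-1) -size_p lead_coef_eq0 -size_poly_gt0 size_p.
pose c := f`_n / (p n)`_n; pose g := f - c *: p n.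
have /IHn gE : (size g <= n)%N.
  apply/leq_sizeP => j; rewrite leq_eqVlt => /orP[/eqP <- | lt_nj].
    by rewrite coefB coefZ divfK // subrr.
  rewrite coefB coefZ (leq_sizeP _ _ le_f) // [(p n)`_j]nth_default.
    by rewrite mulr0 subr0.
  by rewrite size_p.
have fE : f = g + c *: p n by rewrite subrK.
have ortho_n (i : 'I_n) : L (p n * p i) = 0.
  by rewrite p_orthonormal gtn_eqF.
have gp i : L (g * p i) = L (f * p i) - c * L (p n * p i).
  by rewrite mulrBl linearB /= momentZl.
have Lgn : L (g * p n) = 0.
  rewrite gE moment_suml big1 // => i _.
  by rewrite momentZl p_orthonormal ltn_eqF ?mulr0.
have Lfn : L (f * p n) = c.
  by move: (gp n); rewrite Lgn p_orthonormal eqxx mulr1 => /esym/subr0_eq.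
rewrite big_ord_recr /= Lfn [LHS]fE [in LHS]gE; congr (_ + _).
by apply: eq_bigr => i _; rewrite gp ortho_n mulr0 subr0.
Qed.

Lemma parseval n (f g : {poly R}) :
  (size f <= n)%N -> L (f * g) = \sum_(i < n) L (f * p i) * L (g * p i).
Proof.
move=> le_f; rewrite {1}(fourier_expansion le_f) moment_suml.
by apply: eq_bigr => i _; rewrite momentZl (mulrC (p i)).
Qed.

Lemma moment_low_degree (f : {poly R}) j : (size f <= j)%N -> L (f * p j) = 0.
Proof.
move=> le_f; rewrite (parseval _ le_f) big1 // => i _.
by rewrite p_orthonormal gtn_eqF ?mulr0.
Qed.

(** By Parseval, the square norm is the sum of the squares of the Fourier
    coefficients. *)
Lemma moment_posdef f : f != 0 -> 0 < L (f * f).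
Proof.
move=> nz_f; rewrite (parseval _ (leqnn _)) lt0r sumr_ge0 ?andbT; last first.
  by move=> i _; rewrite -expr2 sqr_ge0.
rewrite psumr_eq0; last by move=> i _; rewrite -expr2 sqr_ge0.
apply: contra nz_f => /allP Lf0; rewrite (fourier_expansion (leqnn (size f))).
rewrite big1 // => i _.
have := Lf0 i (mem_index_enum _); rewrite /= mulf_eq0 orbb => /eqP ->.
by rewrite scale0r.
Qed.

(** The matrix of multiplication by q in the basis p has bandwidth deg q: the
    upper limit comes from the degree of q p_j, and the lower one from that of
    q p_r, since multiplication by q is symmetric. *)
Lemma banded_expansion e (q f : {poly R}) j : size q = e.+1 ->
  L (f * (q * p j))
  = \sum_((j - e)%N <= r < (j + e).+1) L (p r * (q * p j)) * L (f * p r).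
Proof.
move=> size_q; have nz_q : q != 0 by rewrite -size_poly_gt0 size_q.
have size_qp r : size (q * p r) = (r + e).+1.
  by rewrite size_mul -?size_poly_gt0 ?size_p ?size_q //= addnS addnC.
rewrite mulrC (@parseval (j + e).+1) ?size_qp // -(big_mkord xpredT
  (fun r => L (q * p j * p r) * L (f * p r))).
rewrite (big_cat_nat (n := (j - e)%N)) //=; last by lia.
rewrite big_nat_cond big1 ?add0r => [|r /andP[/andP[_ lt_r] _]].
  by apply: eq_bigr => r _; congr (L _ * _); rewrite mulrC.
rewrite [q * _ * _]mulrAC (@moment_low_degree (q * p r)) ?mul0r // size_qp; lia.
Qed.

(** * Gram-Schmidt along a list of polynomials of distinct degrees *)

Section Triangular.
Variables (M : nat -> {poly R}) (e : nat -> nat).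
Hypothesis e_inj : injective e.
Hypothesis size_M : forall i, size (M i) = (e i).+1.

Lemma distinct_degree_free n (c : nat -> R) :
  \sum_(i < n) c i *: M i = 0 -> forall i, (i < n)%N -> c i = 0.
Proof.
move=> sum0 i0 lt_i0; apply/eqP; apply: contraT => nz0.
(* The coefficient at the largest degree that occurs cannot cancel. *)
case: (@arg_maxnP _ (Ordinal lt_i0) (fun i => c i != 0) (fun i => e i) nz0)
  => i nz_i max_i.
have := congr1 (fun f : {poly R} => f`_(e i)) sum0.
rewrite coef0 coef_sum (bigD1 i) //= big1 ?addr0 => [/eqP|j neq_ji]; last first.
  rewrite coefZ; have [-> | nz_j] := eqVneq (c j) 0; first by rewrite mul0r.
  rewrite nth_default ?mulr0 // size_M ltn_neqAle
    (max_i j nz_j : (e j <= e i)%N) andbT.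
  by apply: contra neq_ji => /eqP/e_inj/val_inj ->.
rewrite coefZ mulf_eq0 (negPf nz_i) /= -[X in _`_X]/((e i).+1.-1) -size_M.
by rewrite lead_coef_eq0 -size_poly_eq0 size_M.
Qed.

Definition low_span l (f : {poly R}) :=
  exists c : nat -> R, f = \sum_(i < l) c i *: M i.

Lemma low_span_gen l i : (i < l)%N -> low_span l (M i).
Proof.
move=> lt_il; exists (fun j => (j == i)%:R).
rewrite (bigD1 (Ordinal lt_il)) //= eqxx scale1r big1 ?addr0 // => j neq_ji.
by rewrite (_ : (j == i :> nat) = false) ?scale0r //; apply/negbTE.
Qed.

Lemma low_spanD l f g : low_span l f -> low_span l g -> low_span l (f + g).
Proof.
move=> [a ->] [b ->]; exists (fun i => a i + b i).
by rewrite -big_split; apply: eq_bigr => i _; rewrite scalerDl.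
Qed.

Lemma low_spanZ l a f : low_span l f -> low_span l (a *: f).
Proof.
move=> [b ->]; exists (fun i => a * b i).
by rewrite scaler_sumr; apply: eq_bigr => i _; rewrite scalerA.
Qed.

Lemma low_span_sum l (I : finType) (F : I -> {poly R}) :
  (forall i, low_span l (F i)) -> low_span l (\sum_i F i).
Proof.
move=> lowF; elim/big_rec: _ => [|i f _ low_f]; last exact: low_spanD.
by exists (fun=> 0); rewrite big1 // => i _; rewrite scale0r.
Qed.

Lemma low_span_widen k l f : (k <= l)%N -> low_span k f -> low_span l f.
Proof.
move=> le_kl [c ->]; apply: low_span_sum => i; apply: low_spanZ.
by apply: low_span_gen; apply: leq_trans (ltn_ord i) le_kl.
Qed.

(** The leading term of f, for the order of the list M, is a nonzero multiple
    of M l.  The degrees e need not be increasing, so this is not a condition on the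
    degree of f. *)
Definition leads l (f : {poly R}) :=
  exists2 c : R, c != 0 & low_span l (f - c *: M l).

Lemma leads_low_span l f : leads l f -> low_span l.+1 f.
Proof.
move=> [c _ low_f]; rewrite -(subrK (c *: M l) f); apply: low_spanD.
  exact: low_span_widen low_f.
by apply: low_spanZ; apply: low_span_gen.
Qed.

Lemma leadsD l f g : leads l f -> low_span l g -> leads l (f + g).
Proof.
move=> [c nz_c low_f] low_g; exists c => //.
by rewrite addrAC; apply: low_spanD.
Qed.

Lemma leadsZ l a f : a != 0 -> leads l f -> leads l (a *: f).
Proof.
move=> nz_a [c nz_c low_f]; exists (a * c); first by rewrite mulf_neq0.
by rewrite -scalerA -scalerBr; apply: low_spanZ.
Qed.

Lemma leads_neq0 l f : leads l f -> f != 0.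
Proof.
move=> [c nz_c [b fE]]; apply: contraNneq nz_c => f0.
pose b' i := if (i < l)%N then b i else c.
have := @distinct_degree_free l.+1 b' _ l (leqnn _); rewrite /b' ltnn => -> //.
rewrite big_ord_recr /= ltnn.
under eq_bigr => i _ do rewrite ltn_ord.
by rewrite -fE f0 sub0r addNr.
Qed.

(** Since s is increasing, the terms below the leading one stay below it. *)
Lemma leads_mul v s l f : {homo s : i j / (i < j)%N} ->
  (forall t, (t <= l)%N -> v * M t = M (s t)) ->
  leads l f -> leads (s l) (v * f).
Proof.
move=> s_mono vM [c nz_c [b fE]]; exists c => //.
rewrite -vM // scalerAr -mulrBr fE mulr_sumr; apply: low_span_sum => i.
rewrite -scalerAr; apply: low_spanZ; rewrite vM 1?ltnW //.
by apply: low_span_gen; apply: s_mono.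
Qed.

Section GramSchmidt.
Variable y : nat -> {poly R}.

Definition residual l f := f - \sum_(t < l) L (f * y t) *: y t.

(** The y_i with i < l span the same space as the M_i with i < l, because they
    are triangular with respect to them. *)
Lemma orthogonal_low_span l f g : (forall i, (i < l)%N -> leads i (y i)) ->
  (forall i, (i < l)%N -> L (g * y i) = 0) -> low_span l f -> L (g * f) = 0.
Proof.
move=> y_leads g_ortho [c ->]; rewrite moment_sumr big1 // => i _.
rewrite momentZr; suff -> : L (g * M i) = 0 by rewrite mulr0.
have [k] := ubnP (i : nat); have := ltn_ord i.
elim: k (nat_of_ord i) => // k IHk {}i lt_il le_ik.
have [a nz_a [b yE]] := y_leads i lt_il.
have := g_ortho i lt_il; rewrite -(subrK (a *: M i) (y i)) yE mulrDr linearD /=.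
rewrite moment_sumr big1 => [|j _]; last first.
  rewrite momentZr IHk ?mulr0 //; first exact: ltn_trans (ltn_ord j) lt_il.
  exact: leq_trans (ltn_ord j) _.
by rewrite add0r momentZr => /eqP; rewrite mulf_eq0 (negPf nz_a) => /eqP.
Qed.

(** The residual g of f still has M l as leading term, so it is not zero.  As g
    is orthogonal to f - g, <g, f> = <g, g>; therefore the normalised residual
    pairs with f to the norm of g. *)
Lemma gram_schmidt_step l f :
  (forall i, (i < l)%N -> leads i (y i)) ->
  (forall i j, (i < l)%N -> (j < l)%N -> L (y i * y j) = (i == j)%:R) ->
  leads l f ->
  y l = (Num.sqrt (L (residual l f * residual l f)))^-1 *: residual l f ->
  [/\ leads l (y l), forall i, (i < l)%N -> L (y l * y i) = 0,
      L (y l * y l) = 1, 0 < L (y l * f)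
    & L (y l * f) *: y l = residual l f].
Proof.
move=> y_leads y_ortho f_leads yE; set g := residual l f in yE *.
have g_leads : leads l g.
  apply: leadsD => //; rewrite -scaleN1r; apply: low_spanZ.
  apply: low_span_sum => i; apply: low_spanZ.
  by apply: low_span_widen (leads_low_span (y_leads i _)).
have g_pos : 0 < L (g * g) by apply: moment_posdef; apply: leads_neq0 g_leads.
set n := Num.sqrt _ in yE; have n_gt0 : 0 < n by rewrite sqrtr_gt0.
have nz_n : n != 0 by rewrite gt_eqF.
have g_ortho i : (i < l)%N -> L (g * y i) = 0.
  move=> lt_il; rewrite mulrBl linearB /= moment_suml.
  rewrite (bigD1 (Ordinal lt_il)) //= momentZl y_ortho // eqxx mulr1.
  rewrite big1 ?addr0 ?subrr // => j neq_ji.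
  by rewrite momentZl y_ortho // (negPf (neq_ji : (j != i :> nat))) mulr0.
have gf : L (g * f) = L (g * g).
  rewrite -[f in LHS](subrK (\sum_(t < l) L (f * y t) *: y t)).
  rewrite -/(residual l f) -/g.
  rewrite mulrDr linearD /= [X in _ + X]moment_sumr big1 ?addr0 // => i _.
  by rewrite momentZr g_ortho ?mulr0.
have nn : n * n = L (g * g) by rewrite -expr2 sqr_sqrtr // ltW.
have yf : L (y l * f) = n by rewrite yE momentZl gf -nn mulKf.
split.
- by rewrite yE; apply: leadsZ => //; rewrite invr_eq0.
- by move=> i lt_il; rewrite yE momentZl g_ortho ?mulr0.
- by rewrite yE momentZl momentZr -nn mulKf // mulVf.
- by rewrite yf.
- by rewrite yf yE scalerA divff // scale1r.
Qed.

(** One step of the construction.  The condition on M stops at i because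
    multiplication by x does not map the whole list of monomials into itself,
    only its part below level d - 1. *)
Definition built_from v s i :=
  [/\ {homo s : a b / (a < b)%N}, forall t, (t <= i)%N -> v * M t = M (s t)
    & y (s i) = let g := residual (s i) (v * y i) in (Num.sqrt (L (g * g)))^-1 *: g].

Hypothesis y0_leads : leads 0 (y 0%N).
Hypothesis y0_unit : L (y 0%N * y 0%N) = 1.
Hypothesis y_built : forall l, (0 < l)%N ->
  exists v s i, [/\ (i < l)%N, s i = l & built_from v s i].

Lemma gram_schmidt l :
  (forall i, (i < l)%N -> leads i (y i)) /\
  (forall i j, (i < l)%N -> (j < l)%N -> L (y i * y j) = (i == j)%:R).
Proof.
elim: l => [//|l [y_leads y_ortho]].
have [ll lo lu] : [/\ leads l (y l), forall i, (i < l)%N -> L (y l * y i) = 0 &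
    L (y l * y l) = 1].
  case: (posnP l) => [-> | l_gt0]; first by split.
  have [v [s [i [lt_il si [s_mono vM yE]]]]] := y_built l_gt0.
  rewrite si in yE.
  have := @gram_schmidt_step l (v * y i) y_leads y_ortho.
  case=> //; rewrite -[X in leads X]si; apply: leads_mul => //.
  exact: y_leads.
split=> [i | i j]; rewrite ltnS leq_eqVlt => /orP[/eqP ->|lt_i] //.
- exact: y_leads.
- rewrite ltnS leq_eqVlt => /orP[/eqP -> | lt_j]; first by rewrite eqxx.
  by rewrite lo // gtn_eqF.
- rewrite ltnS leq_eqVlt => /orP[/eqP -> | lt_j]; last exact: y_ortho.
  by rewrite mulrC lo // ltn_eqF.
Qed.

Lemma y_leads i : leads i (y i).
Proof. by have [+ _] := gram_schmidt i.+1; apply. Qed.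

Lemma y_orthonormal i j : L (y i * y j) = (i == j)%:R.
Proof.
have [_] := gram_schmidt (maxn i j).+1; apply; rewrite ltnS.
  exact: leq_maxl.
exact: leq_maxr.
Qed.

Lemma built_normalised v s i : built_from v s i ->
  0 < L (y (s i) * (v * y i)) /\
  L (y (s i) * (v * y i)) *: y (s i) = residual (s i) (v * y i).
Proof.
move=> [s_mono vM yE].
have [] := @gram_schmidt_step (s i) (v * y i) => //.
- by move=> j _; apply: y_leads.
- by move=> j k _ _; apply: y_orthonormal.
- by apply: leads_mul => //; apply: y_leads.
Qed.

(** Only the terms with s t >= i of the Fourier expansion of v y_i survive,
    because v y_t is a combination of y_0, ..., y_(s t).  The cuts m1 and m2
    separate the levels of the intended application; below m1 the coefficient
    <y_t, v y_i> is written <y_i, v y_t>. *)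
Lemma connection_recurrence v s i q t0 m1 m2 : built_from v s i ->
  (t0 <= m1)%N -> (m1 <= m2)%N -> (m2 <= s i)%N ->
  (forall t, (t < t0)%N -> (s t < i)%N) ->
  L (y (s i) * (v * y i)) * L (y (s i) * q)
  = L (y i * (v * q))
    - \sum_(t0 <= t < m1) L (y i * (v * y t)) * L (y t * q)
    - \sum_(m1 <= t < m2) L (y t * (v * y i)) * L (y t * q)
    - \sum_(m2 <= t < s i) L (y t * (v * y i)) * L (y t * q).
Proof.
move=> built le_t0 le_m1 le_m2 s_low.
rewrite -momentZl (built_normalised built).2; case: built => s_mono vM _.
rewrite mulrBl linearB /= moment_suml -(big_mkord xpredT
  (fun t => L (L (v * y i * y t) *: y t * q))).
under eq_bigr => t _ do rewrite momentZl (mulrC _ (y t)).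
rewrite (big_cat_nat (n := t0)) //= ?(leq_trans le_t0) ?(leq_trans le_m1) //.
rewrite (big_cat_nat (n := m1) (m := t0)) //= ?(leq_trans le_m1) //.
rewrite (big_cat_nat (n := m2) (m := m1)) //=.
rewrite big_nat_cond big1 ?add0r => [|t /andP[/andP[_ lt_t] _]].
  rewrite !opprD !addrA (mulrC v) -mulrA.
  congr (_ - _ - _ - _); apply: eq_bigr => t _.
  by rewrite mulrCA [v * y t]mulrC.
(* A term below t0: v y_t lies in the span of the y_u with u < i. *)
have s_ge a : (a <= s a)%N.
  by elim: a => // a IHa; apply: leq_ltn_trans IHa (s_mono _ _ _).
rewrite mulrCA [y t * y i]mulrC [v * _]mulrCA [X in X * _](_ : _ = 0) ?mul0r //.
apply: (@orthogonal_low_span i) => [j _|j lt_ji|].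
- exact: y_leads.
- by rewrite y_orthonormal gtn_eqF.
apply: low_span_widen (s_low _ lt_t) _; apply: leads_low_span.
apply: leads_mul => // [u le_u|]; last exact: y_leads.
apply: vM; apply: leq_trans le_u _; apply: ltnW.
exact: leq_ltn_trans (s_ge t) (s_low _ lt_t).
Qed.
End GramSchmidt.
End Triangular.
End Moments.

(** * Order of construction and monomials on the curve *)

Section Indices.
Local Open Scope nat_scope.
Context (d : nat).
Definition level_size n := minn n.+1 d.
Notation base n := (ell d n 1).

Lemma ell_base n k : ell d n k = base n + k.-1.
Proof. by rewrite /ell; case: ifP; rewrite !addn0. Qed.

Lemma big_level (V : nmodType) (F : nat -> V) n a b : 0 < a ->
  \big[+%R/0%R]_(a <= r < b) F (ell d n r)
  = \big[+%R/0%R]_(ell d n a <= l < ell d n b) F l.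
Proof.
move=> a_gt0; have [le_ba | lt_ab] := leqP b a.
  by rewrite !big_geq // (ell_base n b) (ell_base n a); lia.
have -> : ell d n b = b - a + ell d n a.
  by rewrite (ell_base n b) (ell_base n a); lia.
rewrite -[in RHS](add0n (ell d n a)) -{1}[a]add0n !big_addn addnK.
apply: eq_bigr => r _; rewrite (ell_base n a) (ell_base n (r + a)).
by congr F; lia.
Qed.

Hypothesis d_ge3 : 3 <= d.

Lemma base0 : base 0 = 0.
Proof. by rewrite /ell ifT //; lia. Qed.

(** The two formulas for ell agree in that both count the entries of the
    levels below; at n.+1 = d the step crosses from one to the other. *)
Lemma baseS n : base n.+1 = base n + level_size n.
Proof.
rewrite /ell /level_size !addn0.
have tri m : (m * m.+1)./2 = 'C(m.+1, 2) by rewrite bin2 mulnC.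
have triS m : 'C(m.+2, 2) = 'C(m.+1, 2) + m.+1 by rewrite binS bin1.
rewrite -bin2 !tri; have [lt_nd | le_dn] := ltnP n.+1 d.
  by rewrite ltnW // triS; lia.
have [lt_nd | {}le_dn] := ltnP n d.
  have -> : d = n.+1 by lia.
  have := bin2 n.+1; have := mul_bin_diag n.+1 1; rewrite bin1 /=; nia.
have := mul_bin_diag d 1; rewrite bin1 => C2; rewrite mulnS; nia.
Qed.

Lemma base_homo : {homo (fun n => base n) : m n / m <= n}.
Proof.
by apply: homo_leq => // [m n k|n]; [exact: leq_trans | rewrite baseS leq_addr].
Qed.

Lemma base_ge n : n <= base n.
Proof. by elim: n => // n IHn; rewrite baseS /level_size; lia. Qed.

Lemma level_exists l : exists n, l < base n.+1.
Proof. by exists l; apply: base_ge. Qed.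

Definition level l := ex_minn (level_exists l).

Lemma level_bounds l : base (level l) <= l < base (level l).+1.
Proof.
rewrite /level; case: ex_minnP => n -> min_n; rewrite andbT.
case: n min_n => [|n] min_n; first by rewrite base0.
by rewrite leqNgt; apply/negP => /min_n; rewrite ltnn.
Qed.

Lemma level_unique n l : base n <= l < base n.+1 -> level l = n.
Proof.
move=> /andP[le_l lt_l]; have /andP[le_l' lt_l'] := level_bounds l.
apply/eqP; rewrite eqn_leq; apply/andP; split; rewrite leqNgt; apply/negP => lt.
  by have := base_homo lt; lia.
by have := base_homo lt; lia.
Qed.

Lemma level_le m n : m <= n -> level m <= level n.
Proof.
move=> le_mn; rewrite leqNgt; apply/negP => /base_homo.
have := level_bounds m; have := level_bounds n; lia.
Qed.

Lemma level_ell n k : 0 < k <= level_size n -> level (ell d n k) = n.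
Proof. by move=> k_n; apply: level_unique; rewrite baseS (ell_base n k); lia. Qed.

(** The position reached by multiplying the l-th monomial by x (below level
    d - 1), respectively by y.  Since a level starts with the highest power of
    x, multiplication by x preserves the place in the level, whereas
    multiplication by y preserves the distance to its end. *)
Definition shift_x l := l + level_size (level l).
Definition shift_y l := l + level_size (level l).+1.

Lemma shift_x_homo : {homo shift_x : i j / i < j}.
Proof.
move=> i j lt_ij; have := level_le (ltnW lt_ij); rewrite /shift_x /level_size; lia.
Qed.

Lemma shift_y_homo : {homo shift_y : i j / i < j}.
Proof.
move=> i j lt_ij; have := level_le (ltnW lt_ij); rewrite /shift_y /level_size; lia.
Qed.

Lemma shift_x_ell n k : 0 < k <= level_size n ->
  shift_x (ell d n k) = ell d n.+1 k.
Proof. by move=> k_n; rewrite /shift_x level_ell // !(ell_base _ k) baseS; lia. Qed.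

(** The place in the level moves by one as long as the levels grow, and not at
    all afterwards. *)
Lemma shift_y_ell n k : 0 < k <= level_size n ->
  shift_y (ell d n k) = ell d n.+1 (k + (level_size n.+1 - level_size n)).
Proof.
move=> k_n; rewrite /shift_y level_ell // ell_base (ell_base _ (k + _)) baseS.
by move: k_n; rewrite /level_size; lia.
Qed.

Lemma shift_y_top n : n <= d - 2 ->
  shift_y (ell d n n.+1) = ell d n.+1 n.+2.
Proof.
by move=> le_n; rewrite shift_y_ell /level_size; [congr ell; lia | lia].
Qed.

Lemma shift_y_high n k : d - 1 <= n -> 1 <= k <= d ->
  shift_y (ell d n k) = ell d n.+1 k.
Proof.
by move=> le_n k_d; rewrite shift_y_ell /level_size; [congr ell; lia | lia].
Qed.

Lemma level_shift_x l : level (shift_x l) = (level l).+1.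
Proof.
apply: level_unique; rewrite /shift_x !baseS.
have := level_bounds l; rewrite baseS /level_size; lia.
Qed.

Lemma level_shift_y l : level (shift_y l) = (level l).+1.
Proof.
apply: level_unique; rewrite /shift_y !baseS.
have := level_bounds l; rewrite baseS /level_size; lia.
Qed.

(** The l-th monomial is x^a y^b with a + b its level; within a level, a
    decreases to 0. *)
Definition x_exponent l := level_size (level l) - (l - base (level l)).+1.
Definition y_exponent l := level l - x_exponent l.

Lemma x_exponent_lt l : x_exponent l < d.
Proof. have := level_bounds l; rewrite baseS /x_exponent /level_size; lia. Qed.

(** Modulo d the number determines the exponent of x, which is less than d;
    the two exponents determine the level and the place in it. *)
Lemma exponent_inj : injective (fun l => x_exponent l + d * y_exponent l).
Proof.
move=> l m E; have ltl := x_exponent_lt l; have ltm := x_exponent_lt m.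
have Ex : x_exponent l = x_exponent m.
  have := congr1 (modn^~ d) E.
  by rewrite /= !(mulnC d) ![x_exponent _ + _]addnC !modnMDl !modn_small.
have Ey : y_exponent l = y_exponent m.
  move: E; rewrite Ex => /addnI/eqP.
  by rewrite eqn_pmul2l ?(ltn_trans _ d_ge3) // => /eqP.
have El : level l = level m.
  move: Ey; rewrite /y_exponent => Ey.
  have : x_exponent l <= level l by rewrite /x_exponent /level_size; lia.
  have : x_exponent m <= level m by rewrite /x_exponent /level_size; lia.
  lia.
have := level_bounds l; have := level_bounds m; move: Ex.
rewrite /x_exponent El baseS; lia.
Qed.

Lemma exponents_shift_x l : (level l).+1 < d ->
  x_exponent (shift_x l) = (x_exponent l).+1 /\
  y_exponent (shift_x l) = y_exponent l.
Proof.
move=> lt_d; rewrite /y_exponent /x_exponent level_shift_x /shift_x baseS.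
have := level_bounds l; rewrite baseS /level_size; lia.
Qed.

Lemma exponents_shift_y l :
  x_exponent (shift_y l) = x_exponent l /\
  y_exponent (shift_y l) = (y_exponent l).+1.
Proof.
rewrite /y_exponent /x_exponent level_shift_y /shift_y baseS.
have := level_bounds l; rewrite baseS /level_size; lia.
Qed.

Lemma level_below n l : l < base n.+1 -> level l <= n.
Proof.
move=> lt_l; rewrite leqNgt; apply/negP => /base_homo.
by have := level_bounds l; lia.
Qed.

(** These bounds show which inner products <Y_{n+1,k}, v Y_t> vanish: v Y_t
    involves positions up to the shift of t. *)
Lemma shift_x_below n k0 k t : 0 < k0 <= level_size n + 1 -> k0 <= k ->
  t < ell d n k0 -> shift_x t < ell d n.+1 k.
Proof.
rewrite (ell_base n k0) (ell_base n.+1 k) => k0_n le_k lt_t.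
have /level_below : t < base n.+1 by rewrite baseS; lia.
by move: lt_t; rewrite baseS /shift_x /level_size; lia.
Qed.

Lemma shift_y_below n k0 k t : 0 < k0 <= level_size n + 1 ->
  k0 + (level_size n.+1 - level_size n) <= k ->
  t < ell d n k0 -> shift_y t < ell d n.+1 k.
Proof.
rewrite (ell_base n k0) (ell_base n.+1 k) => k0_n le_k lt_t.
have /level_below : t < base n.+1 by rewrite baseS; lia.
by move: lt_t le_k; rewrite baseS /shift_y /level_size; lia.
Qed.

(** For the first entry of level d - 1, where the levels still grow, the
    previous bound would ask for k0 = 0; this one replaces it. *)
Lemma shift_y_below_level n k t : t < base n -> shift_y t < ell d n.+1 k.
Proof.
rewrite (ell_base n.+1 k) baseS; case: n => [|n lt_t]; first by rewrite base0.
by have := level_below lt_t; rewrite /shift_y /level_size; lia.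
Qed.
End Indices.

(** * The weight as a moment functional *)

Section Integral.
Context (R : realType) (I : interval R) (w : R -> R).
Hypothesis w_moments : forall n : nat,
  lebesgue_measure.-integrable [set` I]%classic
    (fun x : R => (x ^+ n * w x)%:E).

Lemma integrable_poly_weight (f : {poly R}) :
  lebesgue_measure.-integrable [set` I]%classic
    (fun x : R => (f.[x] * w x)%:E).
Proof.
have -> : (fun x : R => (f.[x] * w x)%:E) =
    (fun x => (\sum_(i < size f) (f`_i)%:E * (x ^+ i * w x)%:E)%E).
  apply/funext => x; rewrite horner_coef mulr_suml -sumEFin.
  by apply: eq_bigr => i _; rewrite -EFinM mulrA.
apply: integrable_sum => [|i _]; first exact: measurable_itv.
by apply: integrableZl; [exact: measurable_itv | exact: w_moments].
Qed.

Lemma moment_functional : exists L : {scalar {poly R}},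
  forall f g, ip_w I w f g = L (f * g).
Proof.
pose L (f : {poly R}) : R :=
  (\int[lebesgue_measure]_(x in [set` I]%classic) (f.[x] * w x))%R.
have L_lin : scalar L.
  move=> a f g; rewrite /L.
  under eq_Rintegral => x _ do rewrite hornerD hornerZ mulrDl -mulrA.
  rewrite RintegralD ?RintegralZl //; try exact: measurable_itv.
  - exact: integrable_poly_weight.
  - rewrite (_ : _ \o _ = (fun x : R => (a%:E * (f.[x] * w x)%:E)%E)) //.
    apply: integrableZl; first exact: measurable_itv.
    exact: integrable_poly_weight.
  - exact: integrable_poly_weight.
pose mixL := GRing.isLinear.Build R {poly R} R *%R L L_lin.
pose LL : {scalar {poly R}} := HB.pack L mixL.
exists LL => f g; rewrite /ip_w /LL /= /L.
by apply: eq_Rintegral => x _; rewrite hornerM.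
Qed.
End Integral.

Lemma fsum_finite_support (R : realType) (F : nat -> R) n :
  (forall r, (n <= r)%N -> F r = 0) ->
  \sum_(r \in [set: nat]%classic) F r = \sum_(r < n) F r.
Proof.
move=> F0; rewrite fsbig_ord; apply/esym/fsbig_widen => // r [_ /negP].
by rewrite /= -leqNgt => /F0.
Qed.

Lemma ip_curve_ip_w (R : realType) (I : interval R) (w : R -> R) phi
    (f g : bipoly R) :
  ip_curve I w phi f g = ip_w I w f.[phi] g.[phi].
Proof.
have evalE (h : bipoly R) x : eval_xy h x phi.[x] = h.[phi].[x].
  rewrite /eval_xy [h.[_%:P]]horner_coef [h.[phi]]horner_coef !horner_sum.
  apply: eq_bigr => i _.
  by rewrite -polyC_exp !hornerM hornerC horner_exp.
by rewrite /ip_curve /ip_w; apply: eq_Rintegral => x _; rewrite !evalE.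
Qed.

(** * The orthogonal polynomials on the curve *)

Lemma foldl_rcons_spec (T : Type) (x0 : T) (step : seq T -> T -> T) s fs :
  let t := foldl (fun t f => rcons t (step t f)) s fs in
  [/\ size t = (size s + size fs)%N, take (size s) t = s
    & forall i, (i < size fs)%N ->
        nth x0 t (size s + i) = step (take (size s + i) t) (nth x0 fs i)].
Proof.
elim: fs s => [|f fs IHfs] s /=; first by rewrite addn0 take_size.
have [] := IHfs (rcons s (step s f)); rewrite size_rcons; set t := foldl _ _ _.
move=> size_t take_t nth_t; have take_s : take (size s) t = s.
  by rewrite -(@take_takel _ _ (size s).+1) // take_t -cats1 take_size_cat.
split=> // [|[|i] lt_i]; first by rewrite size_t addnS.
  rewrite addn0 take_s -(@nth_take (size s).+1 _ x0) // take_t.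
  by rewrite nth_rcons ltnn eqxx.
by rewrite addnS -addSn nth_t.
Qed.

Section Curve.
Context (R : realType) (I : interval R) (w : R -> R) (d : nat) (phi : {poly R}).
Context (p : nat -> {poly R}) (L : {scalar {poly R}}).
Hypothesis d_ge3 : (3 <= d)%N.
Hypothesis ip_wE : forall f g, ip_w I w f g = L (f * g).

Notation OPs := (OPs_upto I w phi p d).
Notation Q := (OP_seq I w phi p d).
Notation ip := (ip_curve I w phi).
Notation base n := (ell d n 1).

Lemma size_next_level n (s : seq (bipoly R)) :
  size (next_level d n s) = level_size d n.+1.
Proof.
by rewrite /next_level /level_size; case: ifP => le_n;
  rewrite ?size_rcons size_map size_iota; lia.
Qed.

Lemma OPs_spec n : size (OPs n) = base n.+1 /\
  [/\ take (base n.+1) (OPs n.+1) = OPs n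
    & forall i, (i < level_size d n.+1)%N ->
      nth 0 (OPs n.+1) (base n.+1 + i)
      = orthogonalise ip (take (base n.+1 + i) (OPs n.+1))
          (nth 0 (next_level d n (OPs n)) i)].
Proof.
have size_OPs : size (OPs n) = base n.+1.
  elim: n => [|n IHn]; first by rewrite baseS // base0 //= /level_size; lia.
  rewrite /=; have [-> _ _] := foldl_rcons_spec 0 (orthogonalise ip) (OPs n)
    (next_level d n (OPs n)).
  by rewrite size_next_level IHn (baseS _ n.+1).
have [_] := foldl_rcons_spec 0 (orthogonalise ip) (OPs n)
  (next_level d n (OPs n)).
by rewrite size_next_level size_OPs => take_t nth_t; split.
Qed.

Lemma take_OPs m n : (n <= m)%N -> take (base n.+1) (OPs m) = OPs n.
Proof.
elim: m => [|m IHm].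
  by rewrite leqn0 => /eqP ->; rewrite -(OPs_spec 0).1 take_size.
rewrite leq_eqVlt => /orP[/eqP -> | lt_nm].
  by rewrite -(OPs_spec m.+1).1 take_size.
rewrite -(@take_takel _ _ (base m.+1)); last exact: base_homo.
by have [_ [-> _]] := OPs_spec m; apply: IHm.
Qed.

(** The value is independent of the level at which the construction stops,
    because later levels only append to the list. *)
Lemma nth_OPs n l : (l < base n.+1)%N -> nth 0 (OPs n) l = Q l.
Proof.
move=> lt_l; have lt_ll : (l < base l.+1)%N by apply: base_ge.
rewrite /OP_seq -(take_OPs (leq_maxl n l)) nth_take //.
by rewrite -[in RHS](take_OPs (leq_maxr n l)) nth_take.
Qed.

Lemma OP_seq_next n i : (i < level_size d n.+1)%N ->
  Q (base n.+1 + i) = orthogonalise ip (mkseq Q (base n.+1 + i))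
    (nth 0 (next_level d n (OPs n)) i).
Proof.
move=> lt_i; have lt_base : (base n.+1 + i < base n.+2)%N.
  by rewrite (baseS _ n.+1) // ltn_add2l.
have [_ [_ nth_OP]] := OPs_spec n.
apply: etrans (esym (nth_OPs lt_base)) _.
apply: etrans (nth_OP i lt_i) _.
apply: (congr1 (fun s => orthogonalise ip s _)).
apply: (@eq_from_nth _ 0).
  by rewrite size_take (OPs_spec n.+1).1 lt_base size_mkseq.
rewrite size_take (OPs_spec n.+1).1 lt_base.
move=> j lt_j; rewrite nth_take // nth_mkseq // nth_OPs //.
exact: ltn_trans lt_base.
Qed.

Lemma OP_seq_x n k : (n <= d - 2)%N -> (1 <= k <= n.+1)%N ->
  Q (ell d n.+1 k)
  = orthogonalise ip (mkseq Q (ell d n.+1 k))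
      (varx R * Q (ell d n k)).
Proof.
move=> le_n k_n; rewrite !(ell_base d n.+1 k) OP_seq_next; last first.
  by rewrite /level_size; lia.
congr orthogonalise; rewrite /next_level le_n nth_rcons size_map size_iota ifT;
  last by lia.
rewrite (nth_map 0%N) ?size_iota; last by lia.
rewrite nth_iota; last by lia.
rewrite (_ : (1 + k.-1)%N = k); last by lia.
by rewrite nth_OPs // baseS // (ell_base d n k) /level_size; lia.
Qed.

Lemma OP_seq_y_top n : (n <= d - 2)%N ->
  Q (ell d n.+1 n.+2)
  = orthogonalise ip (mkseq Q (ell d n.+1 n.+2))
      (vary R * Q (ell d n n.+1)).
Proof.
move=> le_n; rewrite !(ell_base d n.+1 n.+2) OP_seq_next; last first.
  by rewrite /level_size; lia.
congr orthogonalise; rewrite /next_level le_n nth_rcons size_map size_iota.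
rewrite ltnn eqxx.
by rewrite nth_OPs // baseS // (ell_base d n n.+1) /level_size; lia.
Qed.

Lemma OP_seq_y n k : (d - 1 <= n)%N -> (1 <= k <= d)%N ->
  Q (ell d n.+1 k)
  = orthogonalise ip (mkseq Q (ell d n.+1 k))
      (vary R * Q (ell d n k)).
Proof.
move=> le_n k_d; rewrite !(ell_base d n.+1 k) OP_seq_next; last first.
  by rewrite /level_size; lia.
congr orthogonalise; rewrite /next_level ifF; last by lia.
rewrite (nth_map 0%N) ?size_iota; last by lia.
rewrite nth_iota; last by lia.
rewrite (_ : (1 + k.-1)%N = k); last by lia.
by rewrite nth_OPs // baseS // (ell_base d n k) /level_size; lia.
Qed.

(** The univariate polynomial representing the class of the l-th OP modulo
    y - phi(x). *)
Definition on_curve l : {poly R} := (Q l).[phi].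

Lemma on_curve_orthogonalise f l :
  (orthogonalise ip (mkseq Q l) f).[phi]
  = let g := residual L on_curve l f.[phi] in (Num.sqrt (L (g * g)))^-1 *: g.
Proof.
rewrite /orthogonalise; set g := f - _.
have gE : g.[phi] = residual L on_curve l f.[phi].
  rewrite /g /residual hornerD hornerN horner_sum big_map -(big_mkord xpredT
    (fun t => L (f.[phi] * on_curve t) *: on_curve t)).
  congr (_ - _); rewrite /index_iota subn0; apply: eq_bigr => t _.
  by rewrite hornerZ ip_curve_ip_w ip_wE mul_polyC.
by rewrite hornerZ ip_curve_ip_w ip_wE gE mul_polyC.
Qed.

Definition curve_monomial l : {poly R} :=
  'X^(x_exponent d_ge3 l) * phi ^+ (y_exponent d_ge3 l).

Lemma curve_monomial_shift_x l : (level d_ge3 l <= d - 2)%N ->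
  'X * curve_monomial l = curve_monomial (shift_x d_ge3 l).
Proof.
move=> le_l; have [] := @exponents_shift_x _ d_ge3 l; first by lia.
by rewrite /curve_monomial => -> ->; rewrite exprS mulrA.
Qed.

Lemma curve_monomial_shift_y l :
  phi * curve_monomial l = curve_monomial (shift_y d_ge3 l).
Proof.
have [] := exponents_shift_y d_ge3 l.
by rewrite /curve_monomial => -> ->; rewrite exprS mulrCA.
Qed.

Notation built := (built_from L curve_monomial on_curve).

Lemma built_from_orthogonalise v (vp : {poly R}) s l i :
  (forall f, (v * f).[phi] = vp * f.[phi]) ->
  {homo s : a b / (a < b)%N} ->
  (forall t, (t <= i)%N -> vp * curve_monomial t = curve_monomial (s t)) ->
  s i = l -> Q l = orthogonalise ip (mkseq Q l) (v * Q i) -> built vp s i.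
Proof.
move=> vE s_mono vM sE QE; split => //.
by rewrite sE {1}/on_curve QE on_curve_orthogonalise vE.
Qed.

Lemma on_curve_x (f : bipoly R) : (varx R * f).[phi] = 'X * f.[phi].
Proof. by rewrite hornerM hornerC. Qed.

Lemma on_curve_y (f : bipoly R) : (vary R * f).[phi] = phi * f.[phi].
Proof. by rewrite hornerM hornerX. Qed.

(** Levels up to d - 2 contain only powers of x below d - 1, so multiplying
    them by x yields monomials of the list again. *)
Lemma built_x n k : (n <= d - 2)%N -> (1 <= k <= n.+1)%N ->
  built 'X (shift_x d_ge3) (ell d n k).
Proof.
move=> le_n k_n; have k_lev : (0 < k <= level_size d n)%N.
  by rewrite /level_size; lia.
apply: (built_from_orthogonalise on_curve_x (shift_x_homo d_ge3) _
  (shift_x_ell d_ge3 k_lev)).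
  move=> t /(level_le d_ge3); rewrite level_ell // => le_t.
  by apply: curve_monomial_shift_x; apply: leq_trans le_t le_n.
exact: OP_seq_x.
Qed.

Lemma built_y_top n : (n <= d - 2)%N ->
  built phi (shift_y d_ge3) (ell d n n.+1).
Proof.
move=> le_n; apply: (built_from_orthogonalise on_curve_y (shift_y_homo d_ge3) _
  (shift_y_top d_ge3 le_n)).
  by move=> t _; apply: curve_monomial_shift_y.
exact: OP_seq_y_top.
Qed.

Lemma built_y n k : (d - 1 <= n)%N -> (1 <= k <= d)%N ->
  built phi (shift_y d_ge3) (ell d n k).
Proof.
move=> le_n k_d; apply: (built_from_orthogonalise on_curve_y
  (shift_y_homo d_ge3) _ (shift_y_high d_ge3 le_n k_d)).
  by move=> t _; apply: curve_monomial_shift_y.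
exact: OP_seq_y.
Qed.

Lemma on_curve_built l : (0 < l)%N ->
  exists v s i, [/\ (i < l)%N, s i = l & built v s i].
Proof.
move=> l_gt0; have := level_bounds d_ge3 l; set n := level d_ge3 l => l_n.
pose k := (l - base n).+1; have lE : l = ell d n k.
  by rewrite (ell_base d n k) /k; lia.
case: n => [|n] in l_n k lE *.
  by move: l_n; rewrite baseS // base0 // /level_size; lia.
have base_lt : (base n + level_size d n = base n.+1)%N by rewrite baseS.
have k_n : (k <= level_size d n.+1)%N.
  by move: l_n; rewrite /k (baseS _ n.+1) //; lia.
have ell_lt m : (m <= level_size d n)%N -> (0 < level_size d n)%N ->
    (ell d n m < l)%N.
  by move=> le_m gt0; rewrite lE (ell_base d n m) (ell_base d n.+1 k); lia.
have [le_n | lt_n] := leqP n (d - 2).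
  have [le_kn | lt_nk] := leqP k n.+1.
    exists 'X, (shift_x d_ge3), (ell d n k); rewrite shift_x_ell; last first.
      by rewrite /level_size /k; lia.
    split; [apply: ell_lt; rewrite /level_size; lia | by [] | exact: built_x].
  have kE : k = n.+2 by move: k_n; rewrite /level_size; lia.
  exists phi, (shift_y d_ge3), (ell d n n.+1); rewrite shift_y_top // -kE.
  split; [apply: ell_lt; rewrite /level_size; lia | by [] | exact: built_y_top].
have k_d : (1 <= k <= d)%N by move: k_n; rewrite /level_size /k; lia.
exists phi, (shift_y d_ge3), (ell d n k); rewrite shift_y_high //; last by lia.
split; [apply: ell_lt; rewrite /level_size; lia | by [] | apply: built_y; lia].
Qed.

(** * Connection coefficients and their recurrences *)

Hypothesis size_phi : size phi = d.+1.
Hypothesis size_p : forall n, size (p n) = n.+1.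
Hypothesis p_orthonormal : forall m n, L (p m * p n) = (m == n)%:R.

(** The matrix product is a sum over all r of <x p_i, p_r> <p_r, x^k p_j>:
    finitely supported as x p_i has degree i + 1, and given by Parseval. *)
Lemma imx_exp_jacobi k i j :
  imx_exp (jacobi I w p) k i j = L (p i * ('X^k * p j)).
Proof.
elim: k i j => [|k IHk] i j; first by rewrite expr0 mul1r p_orthonormal.
have X_pE r : p i * ('X * p r) = 'X * p i * p r by rewrite mulrCA mulrA.
have size_Xp : size ('X * p i) = i.+2.
  by rewrite mulrC size_mulX ?size_p // -size_poly_gt0 size_p.
rewrite /imx_exp iterS -/(imx_exp _ k) /imx_mul (@fsum_finite_support _ _ i.+2).
  rewrite exprS -mulrA mulrCA mulrA.
  rewrite (parseval size_p p_orthonormal _ (eq_leq size_Xp)).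
  apply: eq_bigr => r _; rewrite IHk /jacobi ip_wE X_pE.
  by rewrite (mulrC (p r)).
move=> r le_r; rewrite /jacobi ip_wE X_pE.
by rewrite (moment_low_degree size_p p_orthonormal) ?mul0r // size_Xp.
Qed.

Lemma imx_horner_jacobi (q : {poly R}) i j :
  imx_horner q (jacobi I w p) i j = L (p i * (q * p j)).
Proof.
have qE : q = \sum_(k < size q) q`_k *: 'X^k by rewrite -poly_def coefK.
rewrite /imx_horner [in RHS]qE.
rewrite mulr_suml moment_sumr; apply: eq_bigr => k _.
by rewrite imx_exp_jacobi -scalerAl momentZr.
Qed.

Lemma size_curve_monomial l :
  size (curve_monomial l) = (x_exponent d_ge3 l + d * y_exponent d_ge3 l).+1.
Proof.
have nz_phi : phi != 0 by rewrite -size_poly_gt0 size_phi.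
rewrite /curve_monomial size_mul ?expf_neq0 ?polyX_eq0 // size_polyXn addSn /=.
have /polySpred -> : phi ^+ y_exponent d_ge3 l != 0 by rewrite expf_neq0.
by rewrite size_exp size_phi addnS.
Qed.

Lemma on_curve0 : on_curve 0 = p 0%N.
Proof. by rewrite /on_curve /OP_seq /= hornerC. Qed.

Lemma on_curve0_leads : leads curve_monomial 0 (on_curve 0).
Proof.
have /size_poly1P[c nz_c p0E] : size (p 0%N) == 1%N by rewrite size_p.
exists c => //; exists (fun=> 0); rewrite big_ord0 on_curve0 p0E.
have /eqP : (size (curve_monomial 0)).-1 = 0%N.
  rewrite size_curve_monomial /= /x_exponent /y_exponent /x_exponent.
  by rewrite (@level_unique _ d_ge3 0) ?base0 ?baseS //= ?base0 /level_size; lia.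
rewrite /curve_monomial size_curve_monomial /= addn_eq0 muln_eq0.
move=> /andP[/eqP -> /orP[|/eqP ->]]; first by lia.
by rewrite !expr0 mulr1 alg_polyC subrr.
Qed.

Lemma on_curve0_unit : L (on_curve 0 * on_curve 0) = 1.
Proof. by rewrite on_curve0 p_orthonormal. Qed.

Let exp_inj := @exponent_inj d d_ge3.

Lemma on_curve_unit l : L (on_curve l * on_curve l) = 1.
Proof.
by rewrite (y_orthonormal size_p p_orthonormal exp_inj size_curve_monomial
  on_curve0_leads on_curve0_unit on_curve_built) eqxx.
Qed.

Notation C := (connection I w phi p d).
Notation Y n k := (on_curve (ell d n k)).

Lemma connectionE j l : C j l = L (on_curve l * p j).
Proof. by rewrite /connection ip_curve_ip_w ip_wE /OP_P hornerC. Qed.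

Lemma coef_aE v vp n i j : (forall f, (v * f).[phi] = vp * f.[phi]) ->
  coef_a I w phi p d v n i j = L (Y n i * (vp * Y n j)).
Proof. by move=> vE; rewrite /coef_a ip_curve_ip_w ip_wE vE. Qed.

Lemma coef_bE v vp n i j : (forall f, (v * f).[phi] = vp * f.[phi]) ->
  coef_b I w phi p d v n i j = L (Y n.+1 i * (vp * Y n j)).
Proof. by move=> vE; rewrite /coef_b ip_curve_ip_w ip_wE vE. Qed.

Lemma col_sqnorm_connection l : col_sqnorm (fun j => C j l) = 1.
Proof.
rewrite /col_sqnorm (@fsum_finite_support _ _ (size (on_curve l))) => [|r le_r].
  rewrite -(on_curve_unit l) (parseval size_p p_orthonormal _ (leqnn _)).
  by apply: eq_bigr => r _; rewrite connectionE.
by rewrite connectionE (moment_low_degree size_p p_orthonormal) ?mul0r.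
Qed.

(** Two unit columns that are positive multiples of the same column F differ by
    a positive factor of square 1. *)
Lemma unit_column_determined (F : nat -> R) b l :
  0 < b -> (forall j, b * C j l = F j) ->
  unit_norm_determines F b (fun j => C j l).
Proof.
move=> b_gt0 bC; split=> // [|b' c b'_gt0 b'c c_unit].
  exact: col_sqnorm_connection.
have cE : c = fun j => b / b' * C j l.
  by apply/funext => j; rewrite mulrAC bC -b'c mulrC mulKf ?gt_eqF.
have : (b / b') ^+ 2 = 1.
  rewrite -c_unit cE -[LHS]mulr1 -(col_sqnorm_connection l) /col_sqnorm.
  rewrite !(@fsum_finite_support _ _ (size (on_curve l))).
  - by rewrite mulr_sumr; apply: eq_bigr => r _; rewrite expr2 mulrACA.
  - move=> r le_r; rewrite connectionE.
    by rewrite (moment_low_degree size_p p_orthonormal) ?mulr0 ?mul0r.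
  - move=> r le_r; rewrite connectionE.
    by rewrite (moment_low_degree size_p p_orthonormal) ?mulr0 ?mul0r.
move=> /eqP; rewrite sqrp_eq1 ?divr_ge0 ?ltW // => /eqP bb'1.
split; last by apply/funext => j; rewrite cE bb'1 mul1r.
by rewrite -[b']mul1r -bb'1 divfK ?gt_eqF.
Qed.

Lemma column_recurrence v s i l (b : R) (F : nat -> R) :
  built v s i -> s i = l ->
  b = L (on_curve l * (v * on_curve i)) ->
  (forall j, L (on_curve l * (v * on_curve i)) * L (on_curve l * p j) = F j) ->
  [/\ forall j, b * C j l = F j, unit_norm_determines F b (fun j => C j l)
    & ip (Q l) (Q l) = 1].
Proof.
move=> built_l sE -> FE.
have bC j : L (on_curve l * (v * on_curve i)) * C j l = F j.
  by rewrite connectionE.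
split=> //; last by rewrite ip_curve_ip_w ip_wE on_curve_unit.
apply: unit_column_determined => //.
have [] := built_normalised size_p p_orthonormal exp_inj size_curve_monomial
  on_curve0_leads on_curve0_unit on_curve_built built_l.
by rewrite sE.
Qed.

(** The general recurrence cut at the levels n - 1, n and n + 1.  The index k0
    is the first place of level n - 1 whose multiple by v can reach Y_{n,k};
    it may be one more than the size of that level, and then the sum over level
    n - 1 is empty. *)
Lemma level_recurrence v s n k k' k0 q :
  built v s (ell d n k) -> s (ell d n k) = ell d n.+1 k' ->
  (1 <= k0 <= level_size d n.-1 + 1)%N -> (0 < k')%N ->
  (forall t, (t < if n is 0 then 0 else ell d n.-1 k0)%N ->
    (s t < ell d n k)%N) ->
  L (Y n.+1 k' * (v * Y n k)) * L (Y n.+1 k' * q)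
  = L (Y n k * (v * q))
    - (if n is n'.+1 then
         \sum_(k0 <= r < (level_size d n').+1)
           L (Y n k * (v * Y n' r)) * L (Y n' r * q)
       else 0)
    - \sum_(1 <= r < (level_size d n).+1) L (Y n r * (v * Y n k)) * L (Y n r * q)
    - \sum_(1 <= r < k') L (Y n.+1 r * (v * Y n k)) * L (Y n.+1 r * q).
Proof.
move=> built_k sE k0_n k'_gt0 low.
have top m : ell d m (level_size d m).+1 = base m.+1 by rewrite ell_base baseS.
have le_k' : (base n.+1 <= ell d n.+1 k')%N.
  by rewrite [leqRHS]ell_base leq_addr.
have le_n : (base n <= base n.+1)%N by apply: base_homo.
have big m a b := @big_level d R
  (fun l => L (on_curve l * (v * Y n k)) * L (on_curve l * q)) m a b.
rewrite !big // top.
rewrite -sE; case: n => [|n] in built_k sE k0_n low le_k' le_n big *.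
  rewrite (connection_recurrence size_p p_orthonormal exp_inj
    size_curve_monomial on_curve0_leads on_curve0_unit on_curve_built
    (t0 := 0) (m1 := base 0) (m2 := base 1) q built_k) ?base0 ?sE //.
  by rewrite big_geq.
rewrite (connection_recurrence size_p p_orthonormal exp_inj
  size_curve_monomial on_curve0_leads on_curve0_unit on_curve_built
  (t0 := ell d n k0) (m1 := base n.+1) (m2 := base n.+2) q built_k) ?sE //.
  rewrite (@big_level d R
    (fun l => L (Y n.+1 k * (v * on_curve l)) * L (on_curve l * q))) ?top //.
  by case/andP: k0_n.
by rewrite baseS // (ell_base d n k0); move: k0_n => /=; lia.
Qed.

Lemma jacobi_column l j :
  \sum_(j.-1 <= r < j.+2) jacobi I w p r j * C r l
  = L (on_curve l * ('X * p j)).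
Proof.
rewrite (banded_expansion size_p p_orthonormal _ _ (size_polyX R)) subn1 addn1.
by apply: eq_bigr => r _; rewrite connectionE /jacobi ip_wE.
Qed.

Lemma horner_jacobi_column l j :
  \sum_((j - d)%N <= r < (j + d).+1) imx_horner phi (jacobi I w p) r j * C r l
  = L (on_curve l * (phi * p j)).
Proof.
rewrite (banded_expansion size_p p_orthonormal _ _ size_phi).
by apply: eq_bigr => r _; rewrite connectionE imx_horner_jacobi.
Qed.

Notation b v := (coef_b I w phi p d v).
Notation a v := (coef_a I w phi p d v).

(** The common form of all the recurrences.  They differ only in the variable
    v, in the place k' of the new polynomial and in the first place k0 of the
    sum over level n - 1. *)
Lemma curve_recurrence v vp s n k k' k0 (F : nat -> R) :
  (forall f, (v * f).[phi] = vp * f.[phi]) ->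
  built vp s (ell d n k) -> s (ell d n k) = ell d n.+1 k' ->
  (1 <= k0 <= level_size d n.-1 + 1)%N -> (0 < k')%N ->
  (forall t, (t < if n is 0 then 0 else ell d n.-1 k0)%N ->
    (s t < ell d n k)%N) ->
  (forall j, F j = L (Y n k * (vp * p j))
    - (if n is n'.+1 then
         \sum_(k0 <= r < (level_size d n').+1) b v n' k r * C j (ell d n' r)
       else 0)
    - \sum_(1 <= r < (level_size d n).+1) a v n r k * C j (ell d n r)
    - \sum_(1 <= r < k') b v n r k * C j (ell d n.+1 r)) ->
  [/\ forall j, b v n k' k * C j (ell d n.+1 k') = F j,
      unit_norm_determines F (b v n k' k) (fun j => C j (ell d n.+1 k'))
    & ip (OP_Y I w phi p d n.+1 k') (OP_Y I w phi p d n.+1 k') = 1].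
Proof.
move=> vE built_k sE k0_n k'_gt0 low FE.
apply: (column_recurrence built_k sE); first exact: coef_bE.
move=> j; rewrite FE (level_recurrence _ built_k sE k0_n k'_gt0 low).
congr (_ - _ - _ - _).
- case: (n) => // n'; apply: eq_bigr => r _.
  by rewrite (coef_bE _ _ _ vE) connectionE.
- by apply: eq_bigr => r _; rewrite (coef_aE _ _ _ vE) connectionE.
- by apply: eq_bigr => r _; rewrite (coef_bE _ _ _ vE) connectionE.
Qed.

End Curve.

Theorem proposition5p5 (R : realType) (I : interval R) (w : R -> R)
    (d : nat) (phi : {poly R}) (p : nat -> {poly R})
    (hI : admissible_interval I)
    (hw : is_weight I w)
    (hd : (3 <= d)%N)
    (hphi : size phi = d.+1)
    (hp : orthonormal_polys I w p) :
  let X := jacobi I w p in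
  let Y := imx_horner phi (jacobi I w p) in
  let C := connection I w phi p d in
  let col l := fun j : nat => C j l in
  let OP := OP_Y I w phi p d in
  let ip := ip_curve I w phi in
  let ax := coef_a I w phi p d (varx R) in
  let bx := coef_b I w phi p d (varx R) in
  let ay := coef_a I w phi p d (vary R) in
  let bY := coef_b I w phi p d (vary R) in
  let rhs1x n k j :=
    \sum_(j.-1 <= r < j.+2) X r j * C r (ell d n k)
    - \sum_(k <= r < n.+1) bx n.-1 k r * C j (ell d n.-1 r)
    - \sum_(1 <= r < n.+2) ax n r k * C j (ell d n r)
    - \sum_(1 <= r < k) bx n r k * C j (ell d n.+1 r) in
  let rhs1y n j :=
    \sum_((j - d)%N <= r < (j + d).+1) Y r j * C r (ell d n n.+1)
    - (if n is n'.+1 then bY n' n.+1 n * C j (ell d n' n) else 0)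
    - \sum_(1 <= r < n.+2) ay n r n.+1 * C j (ell d n r)
    - \sum_(1 <= r < n.+2) bY n r n.+1 * C j (ell d n.+1 r) in
  let rhs2 k j :=
    \sum_((j - d)%N <= r < (j + d).+1) Y r j * C r (ell d d.-1 k)
    - \sum_(maxn k.-1 1 <= r < d) bY d.-2 k r * C j (ell d d.-2 r)
    - \sum_(1 <= r < d.+1) ay d.-1 r k * C j (ell d d.-1 r)
    - \sum_(1 <= r < k) bY d.-1 r k * C j (ell d d r) in
  let rhs3 n k j :=
    \sum_((j - d)%N <= r < (j + d).+1) Y r j * C r (ell d n k)
    - \sum_(k <= r < d.+1) bY n.-1 k r * C j (ell d n.-1 r)
    - \sum_(1 <= r < d.+1) ay n r k * C j (ell d n r)
    - \sum_(1 <= r < k) bY n r k * C j (ell d n.+1 r) in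
  [/\ (forall n : nat, (n <= d - 2)%N ->
         (forall k : nat, (1 <= k <= n.+1)%N ->
            [/\ forall j : nat,
                  bx n k k * C j (ell d n.+1 k) = rhs1x n k j,
                unit_norm_determines (rhs1x n k) (bx n k k)
                  (col (ell d n.+1 k))
              & ip (OP n.+1 k) (OP n.+1 k) = 1])
         /\
         [/\ forall j : nat,
               bY n n.+2 n.+1 * C j (ell d n.+1 n.+2) = rhs1y n j,
             unit_norm_determines (rhs1y n) (bY n n.+2 n.+1)
               (col (ell d n.+1 n.+2))
           & ip (OP n.+1 n.+2) (OP n.+1 n.+2) = 1]),
      (forall k : nat, (1 <= k <= d)%N ->
         [/\ forall j : nat, bY d.-1 k k * C j (ell d d k) = rhs2 k j,
             unit_norm_determines (rhs2 k) (bY d.-1 k k) (col (ell d d k))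
           & ip (OP d k) (OP d k) = 1])
    & (forall n k : nat, (d <= n)%N -> (1 <= k <= d)%N ->
         [/\ forall j : nat, bY n k k * C j (ell d n.+1 k) = rhs3 n k j,
             unit_norm_determines (rhs3 n k) (bY n k k) (col (ell d n.+1 k))
           & ip (OP n.+1 k) (OP n.+1 k) = 1])].
Proof.
move=> X Y C col OP ip ax bx ay bY rhs1x rhs1y rhs2 rhs3.
have [w_meas w_ge0 w_supp w_mom] := hw; have [size_p _ p_ortho] := hp.
have [L ip_wE] := moment_functional w_mom.
have p_orthonormal m n : L (p m * p n) = (m == n)%:R by rewrite -ip_wE.
have main := @curve_recurrence R I w d phi p L hd ip_wE hphi size_p
  p_orthonormal.
have jacobi_col := jacobi_column d phi ip_wE size_p p_orthonormal.
have horner_col := horner_jacobi_column ip_wE hphi size_p p_orthonormal.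
split=> [n le_n | k k_d | n k le_n k_d].
- have ls_n : level_size d n = n.+1 by rewrite /level_size; lia.
  have ls_p : level_size d n.-1 = n.-1.+1 by rewrite /level_size; lia.
  split=> [k k_n|].
    have k_lev : (0 < k <= level_size d n)%N by rewrite ls_n.
    apply: (main _ _ _ _ _ _ k _ (on_curve_x phi)
      (built_x phi p hd ip_wE le_n k_n) (shift_x_ell hd k_lev)).
    + by lia.
    + by lia.
    + case: (n) ls_p k_n => [//|n'] /= ls_p k_n' t.
      apply: shift_x_below => //; lia.
    + move=> j; rewrite /rhs1x jacobi_col ls_n; congr (_ - _ - _ - _).
      case: (n) ls_p k_n => [|n'] /= ls_p k_n'; last by rewrite ls_p.
      by rewrite big_geq //; lia.
  (* Only the last entry n of level n - 1 contributes; at n = 0, where that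
     level is missing, any positive k0 will do. *)
  apply: (main _ _ _ _ _ _ (maxn n 1) _ (on_curve_y phi)
    (built_y_top phi p hd ip_wE le_n) (shift_y_top hd le_n)).
  + by lia.
  + by lia.
  + case: (n) le_n ls_n ls_p => [//|n'] /= le_n' ls_n' ls_p' t.
    apply: shift_y_below; lia.
  + move=> j; rewrite /rhs1y horner_col ls_n; congr (_ - _ - _ - _).
    case: (n) ls_p => [//|n'] /= ->.
    by rewrite (_ : maxn _ _ = n'.+1) ?big_nat1 //; lia.
- (* Multiplication by y advances the place on going from level d - 2 to level
     d - 1, but no longer from level d - 1 to level d; hence the start k - 1
     (or 1) of the sum over level d - 2. *)
  have [m dE1] : exists m, d.-1 = m.+1 by exists d.-2; lia.
  have dE : m.+2 = d by lia.
  have le_m : (d - 1 <= m.+1)%N by lia.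
  have ls_m1 : level_size d m.+1 = d by rewrite /level_size; lia.
  have ls_m : level_size d m = m.+1 by rewrite /level_size; lia.
  have := main _ _ _ _ k k (maxn k.-1 1) (rhs2 k) (on_curve_y phi)
    (built_y phi p hd ip_wE le_m k_d) (shift_y_high hd le_m k_d).
  rewrite dE dE1; apply.
  + by rewrite /= ls_m; lia.
  + by lia.
  + move=> t; have [le_k1 | lt_1k] := leqP k 1.
      by rewrite (_ : maxn _ _ = 1%N); [apply: shift_y_below_level | lia].
    by apply: shift_y_below; rewrite ?ls_m ?ls_m1; lia.
  + by move=> j; rewrite /rhs2 horner_col ls_m1 ls_m dE1 /= dE.
- have le_dn : (d - 1 <= n)%N by lia.
  have ls m : (d - 1 <= m)%N -> level_size d m = d by rewrite /level_size; lia.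
  case: n le_n le_dn => [|n]; first by lia.
  move=> le_n le_dn.
  apply: (main _ _ _ _ _ _ k _ (on_curve_y phi)
    (built_y phi p hd ip_wE le_dn k_d) (shift_y_high hd le_dn k_d)).
  + by rewrite ls /=; lia.
  + by lia.
  + by move=> t; apply: shift_y_below; rewrite !ls; lia.
  + by move=> j; rewrite /rhs3 horner_col !ls //; lia.
Qed.
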